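(* Let $n\ge 2$ be an integer, let $r>0$, let $\overline B_r\subset\mathbb R^n$ be a closed ball of radius $r$, and let $f:\overline B_r\to\mathbb R$ be a $C^2$ function. Let $M=\{(x,f(x)) : x\in\overline B_r\}\subset\mathbb R^{n+1}$ be its graph and let $H$ be the mean curvature of $M$. Then $$\inf_M|H|<\frac1r .$$
   Context: A $C^2$ function on a closed ball is understood to be $C^2$ up to the boundary (i.e. it is the restriction of a $C^2$ function defined on an open neighborhood of the closed ball). The graph $M$ is oriented by a choice of continuous unit normal field. Let $A$ denote the shape operator of $M$ and $k_1(p)\le\dots\le k_n(p)$ the principal curvatures (eigenvalues of $A$) at $p\in M$. The mean curvature is normalized as the average: $H=\frac1n\sum_{i=1}^n k_i$. (Reversing the orientation changes the sign of $H$ but not $|H|$.) *)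

(* Defs.v *)
From HB Require Import structures.
From mathcomp Require Import all_boot all_order all_algebra.
From mathcomp Require Import all_classical all_reals all_analysis.

Set Implicit Arguments.
Unset Strict Implicit.
Unset Printing Implicit Defensive.

Import Order.TTheory GRing.Theory Num.Theory.
Import numFieldNormedType.Exports.

Local Open Scope classical_set_scope.
Local Open Scope ring_scope.

(* The library's norm `|x| on 'rV[R]_n is the sup norm, so the Euclidean
   structure is set up by hand; the topology is the same. *)
Definition dot (R : realType) (n : nat) (u v : 'rV[R]_n) : R :=
  (u *m v^T) 0 0.

Definition enorm (R : realType) (n : nat) (u : 'rV[R]_n) : R :=
  Num.sqrt (dot u u).

Definition closed_eball (R : realType) (n : nat) (c : 'rV[R]_n) (r : R) :
    set 'rV[R]_n :=
  [set x | enorm (x - c) <= r].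

Definition C1_on (R : realType) (n m : nat) (U : set 'rV[R]_n)
    (g : 'rV[R]_n -> 'rV[R]_m) : Prop :=
  forall x, U x -> differentiable g x /\ {for x, continuous (jacobian g)}.

Definition gradient (R : realType) (n : nat) (f : 'rV[R]_n -> R)
    (x : 'rV[R]_n) : 'rV[R]_n :=
  \row_i 'D_(delta_mx 0 i) f x.

(* Meant for U open. *)
Definition C2_on (R : realType) (n : nat) (U : set 'rV[R]_n)
    (f : 'rV[R]_n -> R) : Prop :=
  (forall x, U x -> differentiable f x) /\ C1_on U (gradient f).

Definition graph_point (R : realType) (n : nat) (f : 'rV[R]_n -> R)
    (x : 'rV[R]_n) : 'rV[R]_(n + 1) :=
  row_mx x (f x)%:M.

Definition graph_over (R : realType) (n : nat) (f : 'rV[R]_n -> R)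
    (D : set 'rV[R]_n) : set 'rV[R]_(n + 1) :=
  graph_point f @` D.

(* The i-th row of this matrix is the i-th partial derivative of
   x |-> (x, f x); the rows form a basis of the tangent space of the graph
   at (x, f x). *)
Definition tangent_basis (R : realType) (n : nat) (f : 'rV[R]_n -> R)
    (x : 'rV[R]_n) : 'M[R]_(n, n + 1) :=
  jacobian (graph_point f) x.

Definition unit_normal_field (R : realType) (n : nat) (f : 'rV[R]_n -> R)
    (D : set 'rV[R]_n) (N : 'rV[R]_(n + 1) -> 'rV[R]_(n + 1)) : Prop :=
  {within graph_over f D, continuous N} /\
  forall x, D x ->
    enorm (N (graph_point f x)) = 1 /\
    forall i, dot (row i (tangent_basis f x)) (N (graph_point f x)) = 0.

(* The shape operator is A(v) = - D_v N on the tangent space. Its matrix S in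
   the basis T := tangent_basis f x satisfies S *m T = - jacobian (N \o X) x,
   with X := graph_point f: the i-th row of S holds the coordinates of
   - D_(T_i) N. As the rows of T are free, pinvmx T extracts coordinates. *)
Definition shape_operator (R : realType) (n : nat) (f : 'rV[R]_n -> R)
    (N : 'rV[R]_(n + 1) -> 'rV[R]_(n + 1)) (x : 'rV[R]_n) : 'M[R]_n :=
  - jacobian (N \o graph_point f) x *m pinvmx (tangent_basis f x).

(* Eigenvalues of the shape operator, with multiplicity, in nondecreasing
   order. Such a sequence is unique, has size n, and exists because the shape
   operator is self-adjoint; the default value [::] is thus never used. *)
Definition principal_curvatures (R : realType) (n : nat) (f : 'rV[R]_n -> R)
    (N : 'rV[R]_(n + 1) -> 'rV[R]_(n + 1)) (p : 'rV[R]_(n + 1)) : seq R :=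
  xget [::] [set k : seq R | sorted <=%R k /\
    char_poly (shape_operator f N (lsubmx p)) =
      \prod_(a <- k) ('X - a%:P)].

Definition mean_curvature (R : realType) (n : nat) (f : 'rV[R]_n -> R)
    (N : 'rV[R]_(n + 1) -> 'rV[R]_(n + 1)) (p : 'rV[R]_(n + 1)) : R :=
  n%:R^-1 * \sum_(k <- principal_curvatures f N p) k.

(* Main.v *)
(* Slide the lower hemisphere of a radius rho slightly larger than r vertically until it
   touches the graph of f from above. For rho close to r the hemisphere is steeper along
   the boundary of the ball than f, so the contact point is interior; there the gradients
   agree and the Hessians are ordered, hence div (grad f / sqrt (1 + |grad f|^2)), which
   is n times the mean curvature up to sign, is at most n / rho < n / r. The same argument
   applied to - f gives a point where this divergence exceeds - n / r. If neither point
   already has |H| < 1 / r, then H changes sign between them and vanishes somewhere on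
   the segment joining them. *)
Require Import Defs.
From HB Require Import structures.
From mathcomp Require Import all_boot all_order all_algebra.
From mathcomp Require Import all_classical all_reals all_analysis.
From mathcomp Require Import ring lra.

Set Implicit Arguments.
Unset Strict Implicit.
Unset Printing Implicit Defensive.

Import Order.TTheory GRing.Theory Num.Theory.
Import numFieldNormedType.Exports.

Local Open Scope classical_set_scope.
Local Open Scope ring_scope.

(** * The Euclidean inner product in coordinates *)

Section Dot.
Context {R : realType} {n : nat}.
Implicit Types (u v w : 'rV[R]_n) (k : R).

Lemma dotE u v : dot u v = \sum_j u 0 j * v 0 j.
Proof. by rewrite /dot mxE; apply: eq_bigr => j _; rewrite mxE. Qed.

Lemma dotC u v : dot u v = dot v u.
Proof. by rewrite !dotE; apply: eq_bigr => j _; rewrite mulrC. Qed.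

Lemma dotDl u v w : dot (u + v) w = dot u w + dot v w.
Proof. by rewrite /dot mulmxDl mxE. Qed.

Lemma dotNl u v : dot (- u) v = - dot u v.
Proof. by rewrite /dot mulNmx mxE. Qed.

Lemma dotBl u v w : dot (u - v) w = dot u w - dot v w.
Proof. by rewrite dotDl dotNl. Qed.

Lemma dotZl k u v : dot (k *: u) v = k * dot u v.
Proof. by rewrite /dot -scalemxAl mxE. Qed.

Lemma dotDr u v w : dot u (v + w) = dot u v + dot u w.
Proof. by rewrite dotC dotDl !(dotC u). Qed.

Lemma dotNr u v : dot u (- v) = - dot u v.
Proof. by rewrite dotC dotNl dotC. Qed.

Lemma dotBr u v w : dot u (v - w) = dot u v - dot u w.
Proof. by rewrite dotDr dotNr. Qed.

Lemma dotZr k u v : dot u (k *: v) = k * dot u v.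
Proof. by rewrite dotC dotZl dotC. Qed.

Lemma dot0l v : dot 0 v = 0.
Proof. by rewrite /dot mul0mx mxE. Qed.

Lemma dot_ge0 u : 0 <= dot u u.
Proof. by rewrite dotE sumr_ge0// => j _; rewrite -expr2 sqr_ge0. Qed.

Lemma dot_eq0 u : dot u u = 0 -> u = 0.
Proof.
move=> u0; apply/rowP => j; rewrite mxE; apply/eqP; rewrite -sqrf_eq0 expr2.
have /psumr_eq0P : forall j, true -> 0 <= u 0 j * u 0 j.
  by move=> i _; rewrite -expr2 sqr_ge0.
by rewrite -dotE => /(_ u0) ->.
Qed.

Lemma dot_delta u j : dot u (delta_mx 0 j) = u 0 j.
Proof.
rewrite dotE (bigD1 j)//= big1 ?addr0 ?mxE ?eqxx ?mulr1// => i ij.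
by rewrite mxE (negbTE ij) andbF mulr0.
Qed.

Lemma sqr_coord_le_dot u j : u 0 j ^+ 2 <= dot u u.
Proof.
rewrite dotE (bigD1 j)//= -expr2 lerDl sumr_ge0// => i _.
by rewrite -expr2 sqr_ge0.
Qed.

(** Squaring removes the root, so that membership in a ball becomes a polynomial inequality. *)
Lemma closed_eballE c (r : R) : 0 < r ->
  closed_eball c r = [set x : 'rV[R]_n | dot (x - c) (x - c) <= r ^+ 2].
Proof.
move=> r0; apply/seteqP; split => x; rewrite /closed_eball /enorm /= => h.
  by rewrite -(sqr_sqrtr (dot_ge0 _)) lerXn2r// ?nnegrE ?sqrtr_ge0 ?ltW.
rewrite -(ger0_norm (ltW r0)) -sqrtr_sqr; exact: ler_wsqrtr.
Qed.

End Dot.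

(** * Differentials of vector-valued maps and of algebraic expressions in them *)

Section IsDiff.
Context {R : realType} {V : normedModType R}.

(** A row-valued map is the finite sum of its coordinates times the basis vectors, and differentials
    add. *)
Lemma is_diff_rV n (M dM : V -> 'rV[R]_n) x :
  (forall j, is_diff x (fun y => M y 0 j : R) (fun h => dM h 0 j)) ->
  is_diff x M dM.
Proof.
move=> H.
have rowE (N : V -> 'rV[R]_n) :
    N = \sum_(j < n) (fun y => N y 0 j *: (delta_mx 0 j : 'rV[R]_n)).
  by apply/funext => y; rewrite fct_sumE [LHS]row_sum_delta.
have S (s : seq 'I_n) : is_diff x
   (\sum_(j <- s) (fun y => M y 0 j *: (delta_mx 0 j : 'rV[R]_n)))
   (\sum_(j <- s) (fun y => dM y 0 j *: (delta_mx 0 j : 'rV[R]_n))).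
  elim: s => [|j s IH]; first by rewrite !big_nil; exact: is_diff_cst.
  rewrite !big_cons; apply: is_diffD.
  apply: DiffDef; first exact/differentiableZl/(@ex_diff _ _ _ _ _ _ _ (H j)).
  rewrite diffZl; last exact: (@ex_diff _ _ _ _ _ _ _ (H j)).
  by rewrite (@diff_val _ _ _ _ _ _ _ (H j)).
by rewrite (rowE M) (rowE dM); exact: S.
Qed.

Lemma is_diff_coord n (M dM : V -> 'rV[R]_n) x j :
  is_diff x M dM -> is_diff x (fun y => M y 0 j : R) (fun h => dM h 0 j).
Proof.
move=> H.
have @f : {linear 'rV[R]_n -> R}.
  by exists (fun N : 'rV[R]_n => N 0 j); do 2![eexists]; do ?[constructor];
     rewrite ?mxE// => ? *; rewrite ?mxE//; move=> ?; rewrite !mxE.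
have fc : continuous f by exact: coord_continuous.
have df : is_diff (M x) f f.
  by apply: DiffDef; [exact: linear_differentiable|exact: diff_lin].
exact: (is_diff_comp H df).
Qed.

Lemma is_diff_dot n (u v du dv : V -> 'rV[R]_n) x :
  is_diff x u du -> is_diff x v dv ->
  is_diff x (fun y => dot (u y) (v y))
    (fun h => dot (du h) (v x) + dot (u x) (dv h)).
Proof.
move=> Hu Hv.
have S (s : seq 'I_n) : is_diff x (\sum_(j <- s) ((fun y => u y 0 j) * (fun y => v y 0 j)))
  (\sum_(j <- s) (u x 0 j *: (fun h => dv h 0 j) + v x 0 j *: (fun h => du h 0 j))).
  elim: s => [|j s IH]; first by rewrite !big_nil; exact: is_diff_cst.
  by rewrite !big_cons; apply: is_diffD; apply: is_diffM; exact: is_diff_coord.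
have -> : (fun y => dot (u y) (v y)) =
    \sum_(j <- index_enum 'I_n) ((fun y => u y 0 j) * (fun y => v y 0 j)).
  by apply/funext => y; rewrite fct_sumE dotE.
apply: is_diff_eq (S _) _; apply/funext => h.
rewrite fct_sumE !dotE -big_split; apply: eq_bigr => j _ /=.
rewrite [RHS]addrC; congr (_ + _); exact: mulrC.
Qed.

Lemma is_diff_sqrt (q dq : V -> R) x : 0 < q x -> is_diff x q dq ->
  is_diff x (fun y => Num.sqrt (q y)) (fun h => (2 * Num.sqrt (q x))^-1 * dq h).
Proof.
move=> q0 Hq; have S := is_derive1_sqrt q0.
have dS : differentiable (@Num.sqrt R) (q x).
  by apply/derivable1_diffP; exact: ex_derive.
apply: DiffDef; first exact: differentiable_comp (ex_diff) dS.
rewrite (_ : (fun y => _) = Num.sqrt \o q)// diff_comp//.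
apply/funext => h /=; rewrite diff_val diff1E// derive1E derive_val.
exact: mulrC.
Qed.

Lemma is_diff_inv (q dq : V -> R) x : q x != 0 -> is_diff x q dq ->
  is_diff x (fun y => (q y)^-1) (fun h => - (q x) ^- 2 * dq h).
Proof.
move=> q0 Hq; apply: DiffDef; first exact: differentiableV.
by rewrite diffV// diff_val.
Qed.

Lemma is_diff_scale n (k dk : V -> R) (v dv : V -> 'rV[R]_n) x :
  is_diff x k dk -> is_diff x v dv ->
  is_diff x (fun y => k y *: v y) (fun h => k x *: dv h + dk h *: v x).
Proof.
move=> Hk Hv; apply: is_diff_rV => j.
rewrite (_ : (fun y => _) = k * (fun y => v y 0 j)); last first.
  by apply/funext => y; rewrite mxE.
apply: is_diff_eq (is_diffM Hk (is_diff_coord j Hv)) _.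
apply/funext => h; rewrite !mxE; congr (_ + _); exact: mulrC.
Qed.

End IsDiff.

(** * First- and second-order conditions at a local maximum *)

Section Calculus.
Context {R : realType}.

(** The first-order expansion at [x] only sees the germ of the map. This serves for the unit normal,
    whose explicit formula holds only near a point. *)
Lemma near_eq_is_diff {V W : normedModType R} (f g df : V -> W) x :
  {near x, f =1 g} -> is_diff x f df -> is_diff x g df.
Proof.
move=> fg [fx <-].
have gE : g \o shift x = cst (g x) + 'd f x +o_ 0 id.
  have := diff_locally fx => fE.
  apply/eqaddoP => e e0.
  have /eqaddoP/(_ e e0) := fE; apply: filterS2; last first.
    by move: fg; rewrite {1}(near_shift 0) /=; apply.
  move=> y.
  rewrite /= !fctE /= -(nbhs_singleton fg) => fgy.
  by rewrite subr0 in fgy; rewrite fgy.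
have fc := diff_continuous fx.
have dE := diff_unique fc gE.
by apply: DiffDef => //; apply/diff_locallyP; rewrite dE.
Qed.

Lemma derive_gt0_right {V : normedModType R} (g dg : V -> R) x v :
  is_diff x g dg -> 0 < dg v ->
  exists2 e, 0 < e & forall t, 0 < t -> t < e -> g x < g (x + t *: v).
Proof.
move=> gx dv0.
have dgx : derivable g x v by apply: diff_derivable.
have Dg : 'D_v g x = dg v by rewrite deriveE// diff_val.
have : (fun h => h^-1 *: ((g \o shift x) (h *: v) - g x)) @ 0^' --> 'D_v g x.
  exact: dgx.
rewrite Dg => /cvgr_gt/(_ 0 dv0); rewrite near_withinE => /nbhs_ballP[e e0 H].
exists e => // t t0 te.
have := H t; rewrite /= /ball /= sub0r normrN gtr0_norm// => /(_ te (lt0r_neq0 t0)).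
by rewrite pmulr_rgt0 ?invr_gt0// subr_gt0 addrC.
Qed.

Lemma is_diff_line {V : normedModType R} (x v : V) (t : R) :
  is_diff t (fun s : R => x + s *: v) (fun s => s *: v).
Proof.
have -> : (fun s : R => x + s *: v) = cst x + ( *:%R^~ v) by [].
apply: is_diff_eq; exact: add0r.
Qed.

(** Here [w] is the gradient of [g] and [dw] its Hessian at [x]. Were [dot (dw b) b] positive, then,
    as [w x = 0], the slope of [g] along [b] would be positive just after [x], and the mean value
    theorem would make [g] exceed [g x] there. *)
Lemma local_max_gradient n (g : 'rV[R]_n -> R) (w dw : 'rV[R]_n -> 'rV[R]_n) x :
  (\forall y \near x, is_diff y g (dot (w y))) -> is_diff x w dw ->
  (\forall y \near x, g y <= g x) ->
  w x = 0 /\ forall b, dot (dw b) b <= 0.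
Proof.
move=> gw ww gmax.
have line (P : 'rV[R]_n -> Prop) v : (\forall y \near x, P y) ->
    exists2 e, 0 < e & forall t, 0 <= t -> t < e -> P (x + t *: v).
  move=> Px; have cl : {for (0:R), continuous (fun s : R => x + s *: v)}.
    by have D := is_diff_line x v 0; exact: differentiable_continuous.
  have : nbhs ((fun s : R => x + s *: v) 0) P by rewrite /= scale0r addr0.
  move/cl => /nbhs_ballP[e e0 H]; exists e => // t t0 te.
  by have := H t; rewrite /ball /= sub0r normrN ger0_norm//; exact.
have wx0 : w x = 0.
  (* A nonzero gradient is itself a direction of strict increase. *)
  apply: dot_eq0; apply/eqP; rewrite eq_le dot_ge0 andbT leNgt.
  apply/negP => dw0.
  have [e e0 He] := derive_gt0_right (nbhs_singleton gw) dw0.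
  have [e' e'0 He'] := line _ (w x) gmax.
  set t := Num.min e e' / 2.
  have m0 : 0 < Num.min e e' by rewrite lt_min e0.
  have t0 : 0 < t by rewrite divr_gt0.
  have : t < Num.min e e' by rewrite gtr_pMr// invf_lt1// ltr1n.
  rewrite lt_min => /andP[te te'].
  by have := He' t (ltW t0) te'; rewrite leNgt He.
split => // b; rewrite leNgt; apply/negP => db0.
have wb : is_diff x (fun y => dot (w y) b) (fun h => dot (dw h) b).
  by apply: is_diff_eq (is_diff_dot ww (is_diff_cst b x)) _;
     apply/funext => h; rewrite [X in _ + X]dotC [X in _ + X]dot0l addr0.
have [e e0] := derive_gt0_right wb db0; rewrite wx0 dot0l => He.
have [e1 e10 He1] := line _ b gw.
have [e2 e20 He2] := line _ b gmax.
set m := Num.min e (Num.min e1 e2).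
have m0 : 0 < m by rewrite !lt_min e0 e10.
set t := m / 2.
have t0 : 0 < t by rewrite divr_gt0.
have : t < m by rewrite gtr_pMr// invf_lt1// ltr1n.
rewrite !lt_min => /and3P[te te1 te2].
have dphi s : 0 <= s -> s <= t ->
    is_diff s (fun r => g (x + r *: b)) (fun h => h * dot (w (x + s *: b)) b).
  move=> s0 st; have := He1 s s0 (le_lt_trans st te1) => Hs.
  apply: is_diff_eq (is_diff_comp (is_diff_line x b s) Hs) _.
  by apply/funext => h /=; rewrite dotC dotZl dotC.
have [||c] := @MVT R (fun r => g (x + r *: b)) (fun s => dot (w (x + s *: b)) b) 0 t t0.
- move=> s; rewrite in_itv/= => /andP[s0 st].
  have D := dphi s (ltW s0) (ltW st).
  apply: DeriveDef; first exact: diff_derivable.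
  by rewrite deriveE// diff_val mul1r.
- apply: derivable_within_continuous => s; rewrite in_itv/= => /andP[s0 st].
  have D := dphi s s0 st.
  exact: diff_derivable.
rewrite in_itv/= => /andP[c0 ct]; rewrite scale0r addr0 subr0 => gE.
have : 0 < g (x + t *: b) - g x.
  by rewrite gE mulr_gt0// He// (lt_trans ct).
by rewrite subr_gt0 ltNge He2// ltW.
Qed.

End Calculus.

(** * The normalized gradient and its divergence as an algebraic form *)

Section Normalize.
Context {R : realType} {n : nat}.
Implicit Types (u p : 'rV[R]_n).

(* [qrad 1 1 p] is the area element of a graph with gradient [p], and
   [- qrad k (-1) y] is the height at [y] of the lower hemisphere of radius [sqrt k]. *)
Definition qrad (k e : R) u : R := Num.sqrt (k + e * dot u u).

Lemma is_diff_qrad {V : normedModType R} k e (v dv : V -> 'rV[R]_n) x :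
  0 < k + e * dot (v x) (v x) -> is_diff x v dv ->
  is_diff x (fun y => qrad k e (v y))
    (fun h => e / qrad k e (v x) * dot (v x) (dv h)).
Proof.
move=> q0 Hv.
have Hq : is_diff x (fun y => k + e * dot (v y) (v y))
    (fun h => e * (2 * dot (v x) (dv h))).
  rewrite (_ : (fun y => _) = cst k + e *: (fun y => dot (v y) (v y)))//.
  apply: is_diff_eq (is_diffD (is_diff_cst k x) (is_diffZ e (is_diff_dot Hv Hv))) _.
  apply/funext => h.
  rewrite [LHS]add0r; congr (_ * _); rewrite dotC; ring.
have r0 : Num.sqrt (k + e * dot (v x) (v x)) != 0 by rewrite gt_eqF// sqrtr_gt0.
apply: is_diff_eq (@is_diff_sqrt _ _ (fun y => k + e * dot (v y) (v y)) _ x q0 Hq) _.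
apply/funext => h; rewrite -/(qrad k e (v x)) in r0 *; field; exact: r0.
Qed.

Lemma is_diff_inv_qrad {V : normedModType R} k e (v dv : V -> 'rV[R]_n) x :
  0 < k + e * dot (v x) (v x) -> is_diff x v dv ->
  is_diff x (fun y => (qrad k e (v y))^-1)
    (fun h => - (e / qrad k e (v x) ^+ 3 * dot (v x) (dv h))).
Proof.
move=> q0 Hv.
have r0 : qrad k e (v x) != 0 by rewrite gt_eqF// sqrtr_gt0.
apply: is_diff_eq (@is_diff_inv _ _ (fun y => qrad k e (v y)) _ x r0 (is_diff_qrad q0 Hv)) _.
by apply/funext => h; field.
Qed.

Lemma is_diff_normalize {V : normedModType R} k e (v dv : V -> 'rV[R]_n) x :
  0 < k + e * dot (v x) (v x) -> is_diff x v dv ->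
  is_diff x (fun y => (qrad k e (v y))^-1 *: v y)
    (fun h => (qrad k e (v x))^-1 *: dv h -
      (e / qrad k e (v x) ^+ 3 * dot (v x) (dv h)) *: v x).
Proof.
move=> q0 Hv; apply: is_diff_eq (is_diff_scale (is_diff_inv_qrad q0 Hv) Hv) _.
by apply/funext => h; rewrite scaleNr.
Qed.

Definition area_elt p : R := qrad 1 1 p.

Lemma area_elt_arg_gt0 p : 0 < 1 + 1 * dot p p.
Proof. by rewrite mul1r ltr_pwDl// dot_ge0. Qed.

Lemma area_elt_gt0 p : 0 < area_elt p.
Proof. by rewrite sqrtr_gt0 area_elt_arg_gt0. Qed.

Lemma sqr_area_elt p : area_elt p ^+ 2 = 1 + dot p p.
Proof. by rewrite sqr_sqrtr ?mul1r// ltW// -[dot p p]mul1r area_elt_arg_gt0. Qed.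

(* The divergence of [p / area_elt p] when [p] is a vector field with Jacobian [A]. *)
Definition curv_form p (A : 'M[R]_n) : R :=
  \tr A / area_elt p - dot (p *m A) p / area_elt p ^+ 3.

(** Turns a sign of the quadratic form of [A] into a sign of a trace. *)
Lemma mxtrace_dot (B A : 'M[R]_n) :
  \tr (B *m A *m B^T) = \sum_i dot (row i B *m A) (row i B).
Proof.
apply: eq_bigr => i _; rewrite /dot -row_mul mxE [RHS]mxE.
by apply: eq_bigr => j _; rewrite ![_^T _ _]mxE [row _ _ _ _]mxE [row i B _ _]mxE.
Qed.

Lemma mxtrace_outer (u v : 'rV[R]_n) : \tr (u^T *m v) = dot v u.
Proof. by rewrite mxtrace_mulC /dot /mxtrace big_ord1. Qed.

(* [B] is the symmetric square root of [1 - p^T p / (area_elt p)^2], so the curvature form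
   is, up to the factor [area_elt p], the sum of the values [dot (b *m A) b] over the rows [b] of [B]. *)
Lemma curv_form_le0 p (A : 'M[R]_n) :
  (forall b, dot (b *m A) b <= 0) -> curv_form p A <= 0.
Proof.
move=> A_nsd; set W := area_elt p.
have W0 : 0 < W := area_elt_gt0 p.
(* Since [dot p p = W ^+ 2 - 1], this [t] makes [B] scale [p] by [W^-1], while [B] fixes the vectors
   orthogonal to [p]. *)
pose t : R := (W * (W + 1))^-1; pose P := p^T *m p; pose B := 1%:M - t *: P.
have BT : B^T = B.
  by rewrite /B linearB /= linearZ /= trmx1 trmx_mul trmxK.
have trPA : \tr (P *m A) = dot (p *m A) p.
  by rewrite -mulmxA mxtrace_outer.
have trPAP : \tr (P *m A *m P) = dot p p * dot (p *m A) p.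
  rewrite -mulmxA mxtrace_mulC -mulmxA.
  rewrite (_ : P *m P = dot p p *: P); last first.
    rewrite /P mulmxA -[p^T *m p *m p^T]mulmxA [p *m p^T]mx11_scalar.
    by rewrite mul_mx_scalar -scalemxAl.
  by rewrite -scalemxAr mxtraceZ mxtrace_mulC trPA.
have : \tr (B *m A *m B^T) <= 0 by rewrite mxtrace_dot sumr_le0.
have -> : \tr (B *m A *m B^T) = \tr A - (t * 2 - t ^+ 2 * dot p p) * dot (p *m A) p.
  rewrite BT /B mulmxBl mul1mx mulmxBr mulmx1 !mxtraceD !raddfN /= mulmxBl mxtraceD raddfN /=.
  rewrite -!scalemxAr -!scalemxAl -?scalemxAr !mxtraceZ trPAP trPA mxtrace_mulC trPA; ring.
have -> : dot p p = W ^+ 2 - 1 by rewrite sqr_area_elt addrC addKr.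
have -> : t * 2 - t ^+ 2 * (W ^+ 2 - 1) = (W ^+ 2)^-1.
  by rewrite /t; field; rewrite !gt_eqF// addr_gt0.
move=> H.
have -> : curv_form p A = (\tr A - (W ^+ 2)^-1 * dot (p *m A) p) / W.
  by rewrite /curv_form -/W; field; rewrite gt_eqF.
by rewrite pmulr_lle0// invr_gt0.
Qed.

(* [s^-1 *: (1 + p^T p)] is the Hessian of a lower hemisphere of radius [s * area_elt p]
   at a point where its gradient is [p]. *)
Lemma curv_form_sphere p (s : R) :
  curv_form p (s^-1 *: (1%:M + p^T *m p)) = n%:R / (s * area_elt p).
Proof.
have W0 : area_elt p != 0 by rewrite gt_eqF// area_elt_gt0.
have pE : dot p p = area_elt p ^+ 2 - 1 by rewrite sqr_area_elt addrC addKr.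
rewrite /curv_form mxtraceZ mxtraceD mxtrace1 mxtrace_outer -scalemxAr dotZl.
rewrite mulmxDr mulmx1 mulmxA dotDl [p *m p^T]mx11_scalar mul_scalar_mx dotZl.
rewrite -/(dot p p) pE [(s * _)^-1]invfM.
by move: s^-1 => k; field.
Qed.

Lemma curv_formB p A B : curv_form p (A - B) = curv_form p A - curv_form p B.
Proof.
by rewrite /curv_form raddfB /= mulmxBr dotBl; ring.
Qed.

(** Turns an upper bound for [- f] into a lower bound for [f]. *)
Lemma curv_formN p A : curv_form (- p) (- A) = - curv_form p A.
Proof.
rewrite /curv_form /area_elt /qrad raddfN /= mulmxN mulNmx opprK dotNr dotNl dotNr.
by rewrite opprK; ring.
Qed.

End Normalize.

(** * The unit normal and the trace of the shape operator of a graph *)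

Section Graph.
Context {R : realType} {n : nat}.
Implicit Types (f : 'rV[R]_n -> R) (U : set 'rV[R]_n).

Lemma mul_jacobian m (g dg : 'rV[R]_n -> 'rV[R]_m) x h :
  is_diff x g dg -> h *m jacobian g x = dg h.
Proof. by move=> gx; rewrite /jacobian mul_rV_lin1 diff_val. Qed.

Lemma eq_mulmx_rV m (A B : 'M[R]_(n, m)) :
  (forall h : 'rV_n, h *m A = h *m B) -> A = B.
Proof. by move=> AB; apply/row_matrixP => i; rewrite !rowE. Qed.

Lemma is_diff_gradient f x :
  differentiable f x -> is_diff x f (dot (gradient f x)).
Proof.
move=> fx; apply: DiffDef => //; apply/funext => h.
rewrite [in LHS](row_sum_delta h) linear_sum dotE /=.
by apply: eq_bigr => i _; rewrite linearZ mxE deriveE//= mulrC.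
Qed.

Lemma C2_is_diff_gradient U f x : C2_on U f -> U x ->
  is_diff x (gradient f) (fun h => h *m jacobian (gradient f) x).
Proof.
move=> [_ dg] /dg[gx _]; apply: DiffDef => //; apply/funext => h.
by rewrite /jacobian mul_rV_lin1.
Qed.

Lemma is_diff_row_mx {V : normedModType R} (u du : V -> 'rV[R]_n)
    (k dk : V -> R) x :
  is_diff x u du -> is_diff x k dk ->
  is_diff x (fun y => row_mx (u y) (k y)%:M : 'rV[R]_(n + 1))
    (fun h => row_mx (du h) (dk h)%:M).
Proof.
move=> Hu Hk; apply: is_diff_rV => j; case: (split_ordP j) => i ->.
  rewrite (_ : (fun y => _) = (fun y => u y 0 i)); last first.
    by apply/funext => y; rewrite row_mxEl.
  rewrite (_ : (fun y => row_mx (du y) _ _ _) = (fun y => du y 0 i)).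
    exact: is_diff_coord.
  by apply/funext => y; rewrite row_mxEl.
rewrite (_ : (fun y => _) = k); last first.
  by apply/funext => y; rewrite row_mxEr ord1 mxE eqxx.
rewrite (_ : (fun y => row_mx (du y) _ _ _) = dk)//.
by apply/funext => y; rewrite row_mxEr ord1 mxE eqxx.
Qed.

Lemma dot_row_mx (u v : 'rV[R]_n) (a b : R) :
  dot (row_mx u a%:M : 'rV[R]_(n + 1)) (row_mx v b%:M) = dot u v + a * b.
Proof.
rewrite !dotE big_split_ord /= big_ord1.
by congr (_ + _); [apply: eq_bigr => i _; rewrite !row_mxEl|rewrite !row_mxEr !mxE].
Qed.

Lemma row_mx_last (w : 'rV[R]_(n + 1)) :
  w = row_mx (lsubmx w) (rsubmx w 0 0)%:M.
Proof. by rewrite -mx11_scalar hsubmxK. Qed.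

Lemma tangent_basisE f x : differentiable f x ->
  tangent_basis f x = row_mx 1%:M (gradient f x)^T.
Proof.
move=> fx; apply: eq_mulmx_rV => h.
rewrite (mul_jacobian _ (is_diff_row_mx (is_diff_id x) (is_diff_gradient fx))).
rewrite mul_mx_row mulmx1 [h *m _]mx11_scalar; congr (row_mx _ _%:M).
by rewrite dotC.
Qed.

(** The divergence of the normalized gradient, which is the trace of the shape operator up to
    sign. *)
Definition div_normal f x : R :=
  curv_form (gradient f x) (jacobian (gradient f) x).

(* At each point there are two unit normals; continuity makes the choice locally constant. *)
Lemma unit_normal_field_near f U (N : 'rV[R]_(n + 1) -> 'rV[R]_(n + 1)) x :
  open U -> C2_on U f -> unit_normal_field f U N -> U x ->
  exists2 s, `|s| = 1 & \forall y \near x, N (graph_point f y) =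
    s *: row_mx (- ((area_elt (gradient f y))^-1 *: gradient f y))
                (area_elt (gradient f y))^-1%:M.
Proof.
move=> oU [df _] [Nc HN] Ux.
(* Orthogonality to the tangent rows expresses the normal through its last coordinate [b]; unit
   length then fixes [b] up to sign. *)
pose b y := rsubmx (N (graph_point f y)) 0 0.
have NE y : U y -> N (graph_point f y) = row_mx (- (b y *: gradient f y)) (b y)%:M.
  move=> Uy; rewrite [LHS]row_mx_last; congr row_mx; apply/rowP => i.
  have [_ /(_ i)] := HN y Uy; rewrite tangent_basisE; last exact: df.
  rewrite [X in dot _ X]row_mx_last -/(b y) row_row_mx row1.
  rewrite [row i _]mx11_scalar dot_row_mx dotC dot_delta !mxE => /eqP.
  by rewrite addr_eq0 => /eqP ->; rewrite mulrC.
have b2 y : U y -> b y ^+ 2 = (area_elt (gradient f y)) ^- 2.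
  move=> Uy; have [+ _] := HN y Uy; rewrite NE// /enorm => N1.
  have : dot (row_mx (- (b y *: gradient f y)) (b y)%:M : 'rV_(n + 1))
             (row_mx (- (b y *: gradient f y)) (b y)%:M) = 1.
    by rewrite -[LHS]sqr_sqrtr ?dot_ge0// N1 expr1n.
  rewrite dot_row_mx dotNl dotNr opprK dotZl dotZr => H.
  apply: (mulIf (x := area_elt (gradient f y) ^+ 2)).
    by rewrite expf_neq0// gt_eqF// area_elt_gt0.
  rewrite mulVf; last by rewrite expf_neq0// gt_eqF// area_elt_gt0.
  rewrite sqr_area_elt -[RHS]H; ring.
have bE y : U y -> b y = Num.sg (b y) * (area_elt (gradient f y))^-1.
  move=> Uy; rewrite [LHS]numEsg; congr (_ * _).
  apply/eqP; rewrite -(@eqrXn2 _ 2)// ?invr_ge0 ?ltW ?area_elt_gt0//.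
  by rewrite real_normK ?num_real // b2// exprVn.
have bx0 : b x != 0.
  by rewrite -sqrf_eq0 b2// invr_eq0 expf_eq0/= gt_eqF// area_elt_gt0.
have nU : \forall y \near x, U y by exact: open_nbhs_nbhs.
have bc : {for x, continuous b}.
  (* [N] is continuous only within the graph over [U]; as [U] is open, [graph_point f y] stays in
     that graph for [y] near [x]. *)
  have NXc : N (graph_point f y) @[y --> x] --> N (graph_point f x).
    have GX : graph_over f U (graph_point f x) by exists x.
    have NcX : N @ within (graph_over f U) (nbhs (graph_point f x)) --> N (graph_point f x).
      by move/subspace_continuousP: Nc => /(_ _ GX).
    have Xc : {for x, continuous (graph_point f)}.
      have D := is_diff_row_mx (is_diff_id x) (is_diff_gradient (df x Ux)).
      exact: (@differentiable_continuous _ _ _ x (graph_point f) (@ex_diff _ _ _ _ _ _ _ D)).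
    move=> P HP.
    have HX : nbhs (graph_point f x) (fun z => graph_over f U z -> P (N z)) by exact: NcX HP.
    have H : \forall y \near x,
        graph_over f U (graph_point f y) -> P (N (graph_point f y)).
      exact: Xc HX.
    by apply: filterS2 H nU => y Hy Uy; apply: Hy; exists y.
  apply: (continuous_comp (f := fun y => N (graph_point f y))
    (g := fun w => rsubmx w 0 0)) => //.
  apply: (continuous_comp (f := rsubmx) (g := fun w => w 0 0)).
    exact: continuous_rsubmx.
  exact: coord_continuous.
exists (Num.sg (b x)); first by rewrite normr_sg bx0.
have bb : \forall y \near x, 0 < b x * b y.
  have : b x * b y @[y --> x] --> b x * b x by exact: (cvgM (cvg_cst (b x)) bc).
  by move=> /cvgr_gt; apply; rewrite -expr2 lt_def sqrf_eq0 bx0 sqr_ge0.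
near=> y.
have Uy : U y by near: y.
have sg_by : Num.sg (b y) = Num.sg (b x).
  have : 0 < b x * b y by near: y.
  move=> /gtr0_sg; rewrite sgrM; case: (sgrP (b x)) (sgrP (b y)) => [||] _ [] _; lra.
rewrite NE// {1 2}(bE y Uy) sg_by scale_row_mx scalerN -scalerA; congr row_mx.
by rewrite scale_scalar_mx.
Unshelve. all: by end_near. Qed.

(** Differentiating the local formula for the normal gives [- A *m T], with [T] the tangent basis
    and [A] explicit; [T] has free rows, so [A] is the shape operator. The absolute value absorbs
    the choice of normal. *)
Lemma mxtrace_shape_operator f U N x :
  open U -> C2_on U f -> unit_normal_field f U N -> U x ->
  `|\tr (shape_operator f N x)| = `|div_normal f x|.
Proof.
move=> oU fC2 HN Ux.
have [s s1 Ns] := unit_normal_field_near oU fC2 HN Ux.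
have dp := C2_is_diff_gradient fC2 Ux.
set p := gradient f x; set J := jacobian (gradient f) x in dp *.
set W := area_elt p; have W0 : W != 0 by rewrite gt_eqF// area_elt_gt0.
have T1 : tangent_basis f x = row_mx 1%:M p^T by rewrite tangent_basisE//; exact: fC2.1.
(* The first block of [T] is the identity, so [A] is read off the first [n] coordinates of the
   derivative of the normal; the last coordinate then agrees because [dot p p = W ^+ 2 - 1]. *)
pose A := s *: (W^-1 *: J - W ^- 3 *: (J *m p^T *m p)).
have q0 := area_elt_arg_gt0 p.
have dF : is_diff x (fun y => (area_elt (gradient f y))^-1 *: gradient f y)
    (fun h => W^-1 *: (h *m J) - (1 / W ^+ 3 * dot p (h *m J)) *: p).
  exact: is_diff_normalize q0 dp.
have dI : is_diff x (fun y => (area_elt (gradient f y))^-1)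
    (fun h => - (1 / W ^+ 3 * dot p (h *m J))).
  exact: is_diff_inv_qrad q0 dp.
have hA h : h *m A = s *: (W^-1 *: (h *m J) - (W ^- 3 * dot p (h *m J)) *: p).
  rewrite -scalemxAr mulmxBr -!scalemxAr !mulmxA [h *m J *m p^T]mx11_scalar.
  by rewrite mul_scalar_mx scalerA [dot p _]dotC.
have dN : is_diff x (N \o graph_point f) (fun h => - (h *m A *m tangent_basis f x)).
  have near_N : \forall y \near x,
      (s *: (fun y => row_mx (- ((area_elt (gradient f y))^-1 *: gradient f y))
                (area_elt (gradient f y))^-1%:M)) y = (N \o graph_point f) y.
    by near=> y; apply/esym; near: y.
  apply: (near_eq_is_diff near_N).
  apply: is_diff_eq (is_diffZ s (is_diff_row_mx (is_diffN dF) dI)) _.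
  apply/funext => h; rewrite T1 mul_mx_row mulmx1 [_ *m p^T]mx11_scalar -/(dot (h *m A) p).
  rewrite hA dotZl dotBl !dotZl [dot (h *m J) p]dotC.
  have -> : dot p p = W ^+ 2 - 1 by rewrite sqr_area_elt addrC addKr.
  rewrite /= [LHS]scale_row_mx scalerN scale_scalar_mx opp_row_mx; congr row_mx.
    by rewrite div1r.
  by rewrite -raddfN; congr (_%:M); field.
have -> : shape_operator f N x = A.
  rewrite /shape_operator.
  have -> : jacobian (N \o graph_point f) x = - (A *m tangent_basis f x).
    by apply: eq_mulmx_rV => h; rewrite (mul_jacobian _ dN) mulmxN mulmxA.
  rewrite opprK mulmxKp//; apply/row_freeP; exists (col_mx 1%:M 0).
  by rewrite T1 mul_row_col mulmx1 mulmx0 addr0.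
rewrite mxtraceZ normrM s1 mul1r /div_normal /curv_form -/p -/J -/W.
congr `| _ |; rewrite raddfB /= !mxtraceZ -mulmxA.
rewrite [\tr (J *m _)]mxtrace_mulC -mulmxA mxtrace_outer mulrC.
by congr (_ - _); rewrite mulrC.
Unshelve. all: by end_near. Qed.

(* The second case is the default value of [principal_curvatures]; it would be excluded by
   the self-adjointness of the shape operator, but it gives [|H| < 1 / r] anyway. *)
Lemma mean_curvature_mxtrace f N p : (0 < n)%N ->
  mean_curvature f N p = n%:R^-1 * \tr (shape_operator f N (lsubmx p)) \/
  mean_curvature f N p = 0.
Proof.
move=> n0; rewrite /mean_curvature /principal_curvatures.
case: xgetP => [k _ [_ kE]|]; last by right; rewrite big_nil mulr0.
left; congr (_ * _).
have sk : size k = n.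
  by have := congr1 (size : {poly R} -> nat) kE; rewrite size_char_poly size_prod_XsubC => -[].
(* Trace and sum of roots are both minus the coefficient of degree [n.-1] of the characteristic
   polynomial. *)
apply: oppr_inj; rewrite -char_poly_trace// kE -sk coefPn_prod_XsubC// sk -lt0n//.
Qed.

End Graph.

(** * Comparison with a hemisphere and the intermediate value argument *)

Section Main.
Context {R : realType} {n : nat}.
Implicit Types (f : 'rV[R]_n -> R) (U : set 'rV[R]_n) (c : 'rV[R]_n) (r : R).

Lemma is_diff_translate c (x : 'rV[R]_n) : is_diff x (fun y => y - c) id.
Proof.
have -> : (fun y => y - c) = id - cst c by [].
by apply: is_diff_eq; exact: subr0.
Qed.

Lemma is_diff_continuous {V W : normedModType R} (g dg : V -> W) x :
  is_diff x g dg -> {for x, continuous g}.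
Proof. by move=> D; exact: differentiable_continuous. Qed.

Lemma continuous_sqr_dist c :
  continuous (fun x : 'rV[R]_n => dot (x - c) (x - c)).
Proof.
move=> x; have T := is_diff_translate c x.
exact: is_diff_continuous (is_diff_dot T T).
Qed.

Lemma compact_closed_eball c r : 0 < r -> compact (closed_eball c r).
Proof.
move=> r0; rewrite closed_eballE//; apply: bounded_closed_compact; last first.
  exact: ((continuous_closedP _).1 (@continuous_sqr_dist c)
    [set t | t <= r ^+ 2] (@closed_le R (r ^+ 2))).
(* The norm here is the sup norm, and each coordinate of [x - c] is bounded by its Euclidean
   length. *)
exists (`|c| + r); split; first exact: num_real.
move=> M cM x /= xr; apply: le_trans (ltW cM).
rewrite -[x](subrK c) (le_trans (ler_normD _ _))// addrC lerD2l.
rewrite [leLHS]mx_normrE; apply/bigmax_leP; split; first exact: ltW.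
move=> -[i j] _ /=; rewrite ord1 -(@ler_pXn2r _ 2)// ?nnegrE ?(ltW r0)//.
rewrite real_normK ?num_real//; exact: le_trans (sqr_coord_le_dot _ _) xr.
Qed.

Lemma closed_eball_segment c r x y t : 0 < r ->
  closed_eball c r x -> closed_eball c r y -> 0 <= t -> t <= 1 ->
  closed_eball c r (x + t *: (y - x)).
Proof.
move=> r0; rewrite !closed_eballE//= => xB yB t0 t1.
have -> : x + t *: (y - x) - c = (1 - t) *: (x - c) + t *: (y - c).
  by apply/rowP => i; rewrite !mxE; ring.
move: (x - c) (y - c) xB yB => u v xB yB.
have uv := dot_ge0 (u - v).
(* The squared length of [(1 - t) *: u + t *: v] is the convex combination of those of [u] and [v]
   minus this term. *)
have : t * (1 - t) * dot (u - v) (u - v) >= 0 by rewrite !mulr_ge0// subr_ge0.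
rewrite !(dotBl, dotBr, dotDl, dotDr, dotZl, dotZr) [dot v u]dotC.
nra.
Qed.

(** The gradient [p] and its Jacobian [J] are left abstract so that the comparison serves both [f]
    and [- f]. Strictness comes from a hemisphere of radius larger than [r]. *)
Lemma curv_form_touching_sphere U f (p : 'rV[R]_n -> 'rV[R]_n)
    (J : 'rV[R]_n -> 'M[R]_n) c r :
  (0 < n)%N -> 0 < r -> open U -> closed_eball c r `<=` U ->
  (forall x, U x -> is_diff x f (dot (p x))) ->
  (forall x, U x -> is_diff x p (fun h => h *m J x)) ->
  exists2 x, closed_eball c r x & curv_form (p x) (J x) < n%:R / r.
Proof.
move=> n0 r0 oU BU Hf Hp.
have cB : closed_eball c r c by rewrite closed_eballE//= subrr dot0l sqr_ge0.
have B0 : closed_eball c r !=set0 by exists c.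
have BE x : closed_eball c r x = (dot (x - c) (x - c) <= r ^+ 2).
  by rewrite closed_eballE.
have EVT (g : 'rV[R]_n -> R) : (forall x, closed_eball c r x -> {for x, continuous g}) ->
    exists2 x, closed_eball c r x & forall y, closed_eball c r y -> g y <= g x.
  move=> gc; have [|x xB gx] := EVT_max_rV B0 (compact_closed_eball r0) (f := g).
    by apply: continuous_in_subspaceT => x; rewrite inE; exact: gc.
  by exists x => [|y yB]; [exact: set_mem|apply: gx; exact: mem_set].
have [|z zB Mz] := EVT (fun x => dot (p x) (x - c)).
  move=> x /BU Ux.
  exact: is_diff_continuous (is_diff_dot (Hp x Ux) (is_diff_translate c x)).
set M := Num.max 0 (dot (p z) (z - c)).
have M0 : 0 <= M by rewrite le_max lexx.
have Mp x : closed_eball c r x -> dot (p x) (x - c) <= M.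
  by move=> xB; rewrite le_max Mz// orbT.
(* With squared radius [k], the hemisphere has [q = d] on the boundary of the ball. Its gradient
   paired with [x - c] is there [r ^+ 2 / d = M + 1], which exceeds the bound [M] for [f]. *)
pose d := r ^+ 2 / (M + 1).
have d0 : 0 < d by rewrite divr_gt0 ?exprn_gt0// ltr_wpDl.
pose k := r ^+ 2 + d ^+ 2.
pose q x := qrad k (- 1) (x - c).
have arg_gt0 x : closed_eball c r x -> 0 < k + -1 * dot (x - c) (x - c).
  by rewrite BE /k => xB; rewrite mulN1r subr_gt0 (le_lt_trans xB)// ltrDl exprn_gt0.
have Hq x : 0 < k + -1 * dot (x - c) (x - c) ->
    is_diff x q (fun h => -1 / q x * dot (x - c) h).
  move=> kx; exact: (@is_diff_qrad _ _ _ k (-1) (fun y => y - c) id x kx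
    (is_diff_translate c x)).
pose w x := p x - (q x)^-1 *: (x - c).
have Hg x : U x -> 0 < k + -1 * dot (x - c) (x - c) -> is_diff x (f + q) (dot (w x)).
  move=> Ux kx; apply: is_diff_eq (is_diffD (Hf x Ux) (Hq x kx)) _.
  apply/funext => h; rewrite /w dotBl dotZl -mulNr; congr (_ + _ * _); exact: mulN1r.
(* The lower hemisphere is the graph of [- q]; sliding it down onto [f] first touches where
   [f - (- q)] is maximal. *)
have [|x xB gx] := EVT (f + q).
  by move=> x xB; exact: is_diff_continuous (Hg x (BU _ xB) (arg_gt0 _ xB)).
exists x => //.
have Ux := BU _ xB; have kx := arg_gt0 _ xB.
have qx0 : 0 < q x by rewrite sqrtr_gt0.
(* At a boundary point [f + q] would strictly increase towards the centre, contradicting maximality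
   on the ball. *)
have xr : dot (x - c) (x - c) < r ^+ 2.
  rewrite lt_neqAle; apply/andP; split; last by rewrite -BE.
  apply/negP => /eqP xr.
  have qd : q x = d.
    rewrite /q /qrad xr /k mulN1r addrAC subrr add0r sqrtr_sqr gtr0_norm//.
  have gt0 : 0 < dot (w x) (c - x).
    rewrite -opprB dotNr /w dotBl dotZl xr qd /d opprB subr_gt0 invf_div divfK.
      by rewrite (le_lt_trans (Mp _ xB))// ltrDl.
    by rewrite gt_eqF// exprn_gt0.
  have [e e0 He] := derive_gt0_right (Hg x Ux kx) gt0.
  pose t := Num.min e 1 / 2.
  have m0 : 0 < Num.min e 1 by rewrite lt_min e0 ltr01.
  have t0 : 0 < t by rewrite divr_gt0.
  have : t < Num.min e 1 by rewrite gtr_pMr// invf_lt1// ltr1n.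
  rewrite lt_min => /andP[te t1].
  have := gx _ (closed_eball_segment r0 xB cB (ltW t0) (ltW t1)).
  by rewrite leNgt He.
have near_lt (a : R) : dot (x - c) (x - c) < a ->
    \forall y \near x, dot (y - c) (y - c) < a.
  by move=> xa; exact: cvgr_lt (@continuous_sqr_dist c x) _ xa.
have nU : \forall y \near x, U y by exact: open_nbhs_nbhs.
have near_g : \forall y \near x, is_diff y (f + q) (dot (w y)).
  have xk : dot (x - c) (x - c) < k by rewrite -subr_gt0 -mulN1r.
  near=> y; apply: Hg; first by near: y.
  by rewrite mulN1r subr_gt0; near: y; exact: near_lt.
have near_max : \forall y \near x, (f + q) y <= (f + q) x.
  by near=> y; apply: gx; rewrite BE ltW//; near: y; exact: near_lt.
(* The Hessian of the hemisphere at the contact point, rewritten with the common gradient [p x]. *)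
pose S : 'M[R]_n := (q x)^-1 *: (1%:M + (p x)^T *m p x).
have Hw := is_diffB (Hp x Ux) (@is_diff_normalize _ _ _ k (-1)
  (fun y => y - c) id x kx (is_diff_translate c x)).
have [wx0 dw_le0] := local_max_gradient near_g Hw near_max.
have px : p x = (q x)^-1 *: (x - c) by apply/eqP; rewrite -subr_eq0 -/(w x) wx0.
have xE : x - c = q x *: p x by rewrite px scalerA divff ?scale1r// gt_eqF.
have : curv_form (p x) (J x - S) <= 0.
  apply: curv_form_le0 => b; apply: le_trans (dw_le0 b); rewrite le_eqVlt; apply/orP; left.
  apply/eqP; congr (dot _ b); rewrite mulmxBr; congr (_ - _).
  rewrite -[qrad _ _ _]/(q x) /S -scalemxAr mulmxDr mulmx1 mulmxA.
  rewrite [b *m _]mx11_scalar mul_scalar_mx -/(dot b (p x)) xE dotZl dotC.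
  by apply/rowP => i; rewrite !mxE; field; rewrite gt_eqF.
rewrite curv_formB subr_le0 curv_form_sphere => /le_lt_trans; apply.
rewrite ltr_pM2l ?ltr0n// ltf_pV2 ?posrE ?mulr_gt0 ?area_elt_gt0//.
rewrite -(@ltr_pXn2r _ 2)// ?nnegrE ?ltW ?mulr_gt0 ?area_elt_gt0//.
(* The product [q x * area_elt (p x)] is the radius of the hemisphere, hence larger than [r]. *)
have -> : (q x * area_elt (p x)) ^+ 2 = k.
  rewrite exprMn sqr_area_elt px dotZl dotZr -[RHS](subrK (dot (x - c) (x - c))).
  have -> : k - dot (x - c) (x - c) = q x ^+ 2 by rewrite sqr_sqrtr ?mulN1r// -mulN1r ltW.
  by field; rewrite gt_eqF.
by rewrite ltrDl exprn_gt0.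
Unshelve. all: by end_near. Qed.

Lemma div_normal_continuous U f x : C2_on U f -> U x ->
  {for x, continuous (div_normal f)}.
Proof.
move=> fC2 Ux; have dp := C2_is_diff_gradient fC2 Ux.
have q0 := area_elt_arg_gt0 (gradient f x).
have Ic : (area_elt (gradient f y))^-1 @[y --> x] --> (area_elt (gradient f x))^-1.
  exact: is_diff_continuous (is_diff_inv_qrad q0 dp).
have pc i : gradient f y 0 i @[y --> x] --> gradient f x 0 i.
  exact: is_diff_continuous (is_diff_coord i dp).
have Jc i j : jacobian (gradient f) y i j @[y --> x] --> jacobian (gradient f) x i j.
  exact: continuous_comp (fC2.2 x Ux).2 (@coord_continuous _ _ _ i j _).
have sumc (F : 'I_n -> 'rV[R]_n -> R) : (forall i, F i y @[y --> x] --> F i x) ->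
    \sum_i F i y @[y --> x] --> \sum_i F i x.
  move=> Fc; exact: (@cvg_big R 'I_n +%R 0 xpredT (@add_continuous _) _
    (nbhs x) (index_enum _) F (fun i => F i x) _ (fun i _ => Fc i)).
have Mc (g h : 'rV[R]_n -> R) : g y @[y --> x] --> g x -> h y @[y --> x] --> h x ->
    g y * h y @[y --> x] --> g x * h x.
  by move=> gc hc; exact: (cvgM gc hc).
pose I y := (area_elt (gradient f y))^-1.
pose J := jacobian (gradient f).
pose D y := \sum_j (\sum_i gradient f y 0 i * J y i j) * gradient f y 0 j.
(* A polynomial in the entries of the gradient and its Jacobian and in the inverse area element, all
   continuous at [x]. *)
have -> : div_normal f = fun y => (\sum_i J y i i) * I y - D y * (I y * I y * I y).
  apply/funext => y; rewrite /div_normal /curv_form exprSr expr2 !invfM dotE.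
  by congr (_ - _ * _); apply: eq_bigr => j _; rewrite mxE.
have Dc : D y @[y --> x] --> D x.
  apply: (sumc (fun j y => _)) => j; apply: (Mc (fun y => _) (fun y => _)) => //.
  by apply: (sumc (fun i y => _)) => i; apply: (Mc (fun y => _) (fun y => _)).
have trc := sumc (fun i y => J y i i) (fun i => Jc i i).
exact: cvgB (Mc _ _ trc Ic) (Mc _ _ Dc (Mc _ _ (Mc _ _ Ic Ic) Ic)).
Qed.

Lemma exists_small_div_normal U f c r :
  (0 < n)%N -> 0 < r -> open U -> closed_eball c r `<=` U -> C2_on U f ->
  exists2 x, closed_eball c r x & `|div_normal f x| < n%:R / r.
Proof.
move=> n0 r0 oU BU fC2.
have df z (Uz : U z) := is_diff_gradient (fC2.1 z Uz).
have dp z (Uz : U z) := C2_is_diff_gradient fC2 Uz.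
have [x xB Kx] := curv_form_touching_sphere n0 r0 oU BU df dp.
have dfN z : U z -> is_diff z (- f) (dot (- gradient f z)).
  move=> Uz; apply: is_diff_eq (is_diffN (df z Uz)) _.
  by apply/funext => h; rewrite dotNl.
have dpN z : U z ->
    is_diff z (- gradient f) (fun h => h *m - jacobian (gradient f) z).
  move=> Uz; apply: is_diff_eq (is_diffN (dp z Uz)) _.
  by apply/funext => h; rewrite mulmxN.
have [y yB] := curv_form_touching_sphere n0 r0 oU BU dfN dpN.
rewrite curv_formN -/(div_normal f y) => Ky.
rewrite -/(div_normal f x) in Kx.
have nr0 : 0 < n%:R / r by rewrite divr_gt0// ltr0n.
(* A value at [x] that is at least 0, or at [y] at most 0, turns the one-sided bound into a bound on
   the absolute value; otherwise the signs at [x] and [y] are opposite. *)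
have [Kx0|Kx0] := leP 0 (div_normal f x); first by exists x; rewrite ?ger0_norm.
have [Ky0|Ky0] := leP (div_normal f y) 0; first by exists y; rewrite ?ler0_norm.
have segB t : t \in `[0, 1]%R -> closed_eball c r (x + t *: (y - x)).
  by rewrite in_itv/= => /andP[? ?]; exact: closed_eball_segment.
have [|||t t01 Kt] := @IVT R (fun t => div_normal f (x + t *: (y - x))) 0 1 0.
- by [].
- apply: continuous_in_subspaceT => t; rewrite inE => /segB/BU Ut.
  exact: continuous_comp (is_diff_continuous (is_diff_line x (y - x) t))
    (div_normal_continuous fC2 Ut).
- by rewrite scale0r addr0 scale1r subrKC ge_min le_max (ltW Kx0) (ltW Ky0) orbT.
by exists (x + t *: (y - x)); rewrite ?Kt ?normr0//; exact: segB.
Qed.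

End Main.

Theorem theorem1p1 (R : realType) (n : nat) (hn : (2 <= n)%N) (r : R)
    (hr : 0 < r) (c : 'rV[R]_n) (f : 'rV[R]_n -> R)
    (U : set 'rV[R]_n) (hU : open U) (hBU : closed_eball c r `<=` U)
    (hf : C2_on U f)
    (N : 'rV[R]_(n + 1) -> 'rV[R]_(n + 1)) (hN : unit_normal_field f U N) :
  inf [set `|mean_curvature f N p| | p in graph_over f (closed_eball c r)]
    < r^-1.
Proof.
have n0 : (0 < n)%N by exact: ltn_trans hn.
have [x xB Kx] := exists_small_div_normal n0 hr hU hBU hf.
have Hx : `|mean_curvature f N (graph_point f x)| < r^-1.
  case: (mean_curvature_mxtrace f N (graph_point f x) n0) => -> //.
    rewrite row_mxKl normrM (mxtrace_shape_operator hU hf hN); last exact: hBU.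
    by rewrite normfV normr_nat -ltr_pdivlMl ?invr_gt0 ?ltr0n// invrK.
  by rewrite normr0 invr_gt0.
(* An infimum lies below each value only for a set bounded below; here 0 is a bound. *)
apply: le_lt_trans Hx; apply: ge_inf.
  by exists 0 => _ [p _ <-].
by exists (graph_point f x) => //; exists x.
Qed.
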